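(* For each odd integer $n\geq 3$, $d_{\mathrm{cb}}\big(W_n^-,\mathrm{conv}(\mathrm{Aut}(M_n(\mathbb{C})))\big)=\frac{2}{n}$.
   Context: $W_n^-(x)=\frac{1}{n-1}(\mathrm{Tr}_n(x)1_n-x^t)$ is the Holevo–Werner channel on $M_n(\mathbb{C})$ ($\mathrm{Tr}_n$ the non-normalized trace, $x^t$ the transpose). $\mathrm{Aut}(M_n(\mathbb{C}))$ is the set of maps $x\mapsto u^*xu$ with $u$ unitary, $\mathrm{conv}$ denotes convex hull, and $d_{\mathrm{cb}}(T,\mathcal{C})=\inf_{R\in\mathcal{C}}\|T-R\|_{\mathrm{cb}}$. *)

(* Defs.v *)
From HB Require Import structures.
From mathcomp Require Import all_boot all_order all_algebra.
From mathcomp Require Import classical_sets reals.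
From mathcomp Require Import complex.
Set Implicit Arguments. Unset Strict Implicit. Unset Printing Implicit Defensive.
Import Order.TTheory GRing.Theory Num.Theory.
Local Open Scope ring_scope.
Local Open Scope classical_set_scope.

Section HW.
Variable R : realType.
Local Notation C := (R[i]).

Definition adj (p q : nat) (A : 'M[C]_(p, q)) : 'M[C]_(q, p) :=
  (map_mx (@conjc R) A)^T.

Definition unitary (n : nat) (u : 'M[C]_n) : Prop := u *m adj u = 1%:M.

Definition vnorm (q : nat) (v : 'cV[C]_q) : R :=
  Num.sqrt (\sum_(i < q) (Normc.normc (v i 0)) ^+ 2).

Definition opnorm (p q : nat) (A : 'M[C]_(p, q)) : R :=
  sup [set x : R | exists v : 'cV[C]_q, vnorm v <= 1 /\ x = vnorm (A *m v)].

Definition blk (k n : nat) (B : 'I_k -> 'I_k -> 'M[C]_n) :=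
  @mxblock C k k (fun _ => n) (fun _ => n) B.

Definition cbnorm (n : nat) (T : 'M[C]_n -> 'M[C]_n) : R :=
  sup [set x : R | exists (k : nat) (B : 'I_k -> 'I_k -> 'M[C]_n),
         opnorm (blk B) <= 1 /\ x = opnorm (blk (fun i j => T (B i j)))].

Definition Aut (n : nat) : set ('M[C]_n -> 'M[C]_n) :=
  [set T | exists u : 'M[C]_n, unitary u /\ T = (fun x => adj u *m x *m u)].

Definition conv (n : nat) (S : set ('M[C]_n -> 'M[C]_n)) :
  set ('M[C]_n -> 'M[C]_n) :=
  [set T | exists (m : nat) (l : 'I_m -> R) (F : 'I_m -> 'M[C]_n -> 'M[C]_n),
     (forall i, 0 <= l i) /\ \sum_(i < m) l i = 1 /\ (forall i, S (F i)) /\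
     T = (fun x => \sum_(i < m) real_complex R (l i) *: F i x)].

Definition dcb (n : nat) (T : 'M[C]_n -> 'M[C]_n) (S : set ('M[C]_n -> 'M[C]_n)) : R :=
  inf [set x : R | exists Q, S Q /\ x = cbnorm (fun y => T y - Q y)].

Definition Wminus (n : nat) (x : 'M[C]_n) : 'M[C]_n :=
  (n.-1%:R)^-1 *: ((\tr x)%:M - x^T).

End HW.

(* Main.v *)
Require Import Defs.
From HB Require Import structures.
From mathcomp Require Import all_boot all_order all_algebra.
From mathcomp Require Import classical_sets reals.
From mathcomp Require Import complex.
From mathcomp Require Import ring lra.
Set Implicit Arguments. Unset Strict Implicit. Unset Printing Implicit Defensive.
Import Order.TTheory GRing.Theory Num.Theory.
Local Open Scope ring_scope.

(* Upper bound. For [c] in Z/n let [u_c] be the anti-diagonal unitary supported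
   on [a + p = c], antisymmetric off the fixed points of [a |-> c - a] and with
   independent random signs on the orbits. Each pair of indices lies on exactly
   one anti-diagonal, so averaging [x |-> u^* x u] over [c] and the signs gives
   [R = ((n-1) W + D) / n], with [D x] the diagonal part of [x]. Both [W] and
   [D] are unital and completely positive, whence
   |W - R|_cb = |W - D|_cb / n <= 2/n.

   Lower bound. Apply [id (x) (W - Q)] to the flip, which has norm 1, and take
   the diagonal coefficient at the maximally entangled vector: [W] contributes
   [-1], and [x |-> u^* x u] contributes the real part of
   [(1/n) \sum_(i, j) (u_ji)^* u_ij]. For odd [n] the latter is at least
   [(2 - n) / n], because the antisymmetric matrix [u - u^T] is singular. *)

(** * Weighted Cauchy-Schwarz inequality *)

Section RealSums.
Variable R : realFieldType.

(** Lagrange's identity: twice the gap between the two sides is the sum of the nonnegative terms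
    [G i j]. *)
Lemma weighted_cauchy_schwarz (I : finType) (t a b : I -> R) :
  (forall i, 0 <= t i) ->
  (\sum_i t i * (a i * b i)) ^+ 2 <=
  (\sum_i t i * a i ^+ 2) * (\sum_i t i * b i ^+ 2).
Proof.
move=> t0.
pose G i j := t i * t j * (a i * b j - a j * b i) ^+ 2.
have G0 : 0 <= \sum_i \sum_j G i j.
  by apply: sumr_ge0 => i _; apply: sumr_ge0 => j _;
     rewrite /G mulr_ge0 ?sqr_ge0 // mulr_ge0.
have E (f g : I -> R) :
    \sum_i \sum_j f i * g j = (\sum_i f i) * (\sum_i g i).
  by rewrite mulr_suml; apply: eq_bigr => i _; rewrite mulr_sumr.
have GE : \sum_i \sum_j G i j =
    (\sum_i t i * a i ^+ 2) * (\sum_i t i * b i ^+ 2) *+ 2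
    - (\sum_i t i * (a i * b i)) ^+ 2 *+ 2.
  rewrite !mulr2n {2}[(\sum_i t i * a i ^+ 2) * _]mulrC expr2 -!E.
  rewrite -!big_split -sumrB /=; apply: eq_bigr => i _.
  rewrite -!big_split -sumrB /=; apply: eq_bigr => j _.
  rewrite /G; ring.
by rewrite GE subr_ge0 lerMn2r /= in G0.
Qed.

Lemma weighted_cauchy_schwarz_le (I : finType) (t a b : I -> R) (x y : R) :
  (forall i, 0 <= t i) -> 0 <= x -> 0 <= y ->
  \sum_i t i * a i ^+ 2 <= x ^+ 2 -> \sum_i t i * b i ^+ 2 <= y ^+ 2 ->
  \sum_i t i * (a i * b i) <= x * y.
Proof.
move=> t0 x0 y0 ax bY; have xy0 : 0 <= x * y by rewrite mulr_ge0.
have [s0|s0] := leP (\sum_i t i * (a i * b i)) 0; first exact: le_trans s0 xy0.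
rewrite -(@ler_pXn2r _ 2) ?nnegrE //; last exact: ltW.
apply: le_trans (weighted_cauchy_schwarz a b t0) _.
by rewrite exprMn ler_pM //; apply: sumr_ge0 => i _; rewrite mulr_ge0 ?sqr_ge0.
Qed.

End RealSums.

(** * Euclidean and operator norms of complex matrices *)

Section Norms.
Variable R : realType.
Local Notation C := (R[i]).
Local Notation normc := (@Normc.normc R).
Local Notation "x %:C" := (real_complex R x).

Lemma normc_ge0 (z : C) : 0 <= normc z.
Proof. by case: z => a b; apply: sqrtr_ge0. Qed.

Lemma sqr_normcE (a b : R) : normc (Complex a b) ^+ 2 = a ^+ 2 + b ^+ 2.
Proof. by rewrite /= sqr_sqrtr // addr_ge0 ?sqr_ge0. Qed.

Lemma normc_realM (t : R) (z : C) : 0 <= t -> normc (t%:C * z) = t * normc z.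
Proof.
by move=> t0; rewrite Normc.normcM /= expr0n addr0 sqrtr_sqr ger0_norm.
Qed.

Lemma ler_normc_sum (I : finType) (F : I -> C) :
  normc (\sum_i F i) <= \sum_i normc (F i).
Proof.
elim/big_ind2: _ => [|x a y b xa yb|//]; first by rewrite Normc.normc0.
by apply: le_trans (le_normcD _ _) _; apply: lerD.
Qed.

Lemma adjM p q r (A : 'M[C]_(p, q)) (B : 'M[C]_(q, r)) :
  adj (A *m B) = adj B *m adj A.
Proof. by rewrite /adj map_mxM trmx_mul. Qed.

Lemma adjK p q (A : 'M[C]_(p, q)) : adj (adj A) = A.
Proof. by apply/matrixP => i j; rewrite !mxE conjcK. Qed.

Definition ip q (w v : 'cV[C]_q) : C := (adj w *m v) 0 0.

Lemma ipE q (w v : 'cV[C]_q) : ip w v = \sum_i conjc (w i 0) * v i 0.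
Proof. by rewrite /ip mxE; apply: eq_bigr => i _; rewrite !mxE. Qed.

Lemma ipB q (w v v' : 'cV[C]_q) : ip w (v - v') = ip w v - ip w v'.
Proof. by rewrite /ip mulmxBr !mxE. Qed.

Lemma ip_adj p q (A : 'M[C]_(p, q)) (w : 'cV_p) (v : 'cV_q) :
  ip (adj A *m w) v = ip w (A *m v).
Proof. by rewrite /ip adjM adjK mulmxA. Qed.

Lemma ip_sum q (I : finType) (t : I -> C) w (v : I -> 'cV[C]_q) :
  ip w (\sum_i t i *: v i) = \sum_i t i * ip w (v i).
Proof.
rewrite /ip mulmx_sumr summxE; apply: eq_bigr => i _.
by rewrite -scalemxAr mxE.
Qed.

Lemma vnorm_ge0 q (v : 'cV[C]_q) : 0 <= vnorm v.
Proof. exact: sqrtr_ge0. Qed.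

Lemma sqr_vnorm q (v : 'cV[C]_q) :
  vnorm v ^+ 2 = \sum_i normc (v i 0) ^+ 2.
Proof. by rewrite sqr_sqrtr // sumr_ge0 // => i _; rewrite sqr_ge0. Qed.

Lemma sqr_normc_mul (z : C) : conjc z * z = (normc z ^+ 2)%:C.
Proof.
case: z => a b; rewrite sqr_normcE; apply/eqP; rewrite eq_complex /=.
by apply/andP; split; apply/eqP; ring.
Qed.

Lemma ipvv q (v : 'cV[C]_q) : ip v v = (vnorm v ^+ 2)%:C.
Proof.
rewrite ipE sqr_vnorm rmorph_sum /=; apply: eq_bigr => i _.
exact: sqr_normc_mul.
Qed.

Lemma normc_ip_le q (w v : 'cV[C]_q) : normc (ip w v) <= vnorm w * vnorm v.
Proof.
rewrite ipE; apply: le_trans (ler_normc_sum _) _.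
under eq_bigr => i _ do
  rewrite Normc.normcM -[normc (conjc _) * _]mul1r.
apply: weighted_cauchy_schwarz_le => //; rewrite ?vnorm_ge0 // sqr_vnorm;
  apply: ler_sum => i _; rewrite mul1r //.
by case: (w i 0) => a b /=; rewrite sqrrN.
Qed.

(** Duality: test with [w = v] and cancel one factor [vnorm v]. *)
Lemma vnorm_le_ip q (v : 'cV[C]_q) (c : R) : 0 <= c ->
  (forall w, normc (ip w v) <= vnorm w * c) -> vnorm v <= c.
Proof.
move=> c0 H; have := H v; rewrite ipvv /= expr0n addr0 sqrtr_sqr.
rewrite ger0_norm ?sqr_ge0 // expr2.
have [v0|v0 _] := ltP 0 (vnorm v); first by rewrite ler_pM2l.
exact: le_trans c0.
Qed.

Lemma vnormB q (v w : 'cV[C]_q) : vnorm (v - w) <= vnorm v + vnorm w.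
Proof.
apply: vnorm_le_ip => [|x]; first by rewrite addr_ge0 ?vnorm_ge0.
rewrite ipB; apply: le_trans (le_normcD _ _) _; rewrite normcN mulrDr.
by apply: lerD; apply: normc_ip_le.
Qed.

Lemma vnormZ q (t : R) (v : 'cV[C]_q) :
  0 <= t -> vnorm (t%:C *: v) = t * vnorm v.
Proof.
move=> t0; rewrite /vnorm.
under eq_bigr => i _ do rewrite mxE normc_realM // exprMn.
by rewrite -mulr_sumr sqrtrM ?sqr_ge0 // sqrtr_sqr ger0_norm.
Qed.

Lemma vnorm0 q : vnorm (0 : 'cV[C]_q) = 0.
Proof.
by rewrite /vnorm big1 ?sqrtr0 // => i _; rewrite mxE Normc.normc0 expr0n.
Qed.

Lemma vnorm_eq0 q (v : 'cV[C]_q) : (vnorm v == 0) = (v == 0).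
Proof.
apply/eqP/eqP => [v0|->]; last exact: vnorm0.
have : \sum_i normc (v i 0) ^+ 2 == 0 by rewrite -sqr_vnorm v0 expr0n.
rewrite psumr_eq0 => [/allP H|i _]; last exact: sqr_ge0.
apply/colP => i; rewrite mxE; apply: Normc.eq0_normc; apply/eqP.
by rewrite -sqrf_eq0; apply: H; rewrite mem_index_enum.
Qed.

(** Squared Hilbert-Schmidt norm. It bounds the set whose supremum is [opnorm], and later measures
    [u + u^T] in the lower bound. *)
Definition hs2 p q (A : 'M[C]_(p, q)) : R :=
  \sum_i \sum_j normc (A i j) ^+ 2.

Lemma hs2_ge0 p q (A : 'M[C]_(p, q)) : 0 <= hs2 A.
Proof. by do 2![apply: sumr_ge0 => ? _]; apply: sqr_ge0. Qed.

Lemma sqr_vnorm_mulmx p q (A : 'M[C]_(p, q)) (v : 'cV_q) :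
  vnorm (A *m v) ^+ 2 <= hs2 A * vnorm v ^+ 2.
Proof.
rewrite sqr_vnorm mulr_suml; apply: ler_sum => i _.
have -> : (A *m v) i 0 = ip (adj (row i A)) v.
  by rewrite /ip adjK -row_mul [RHS]mxE.
apply: le_trans (_ : _ <= (vnorm (adj (row i A)) * vnorm v) ^+ 2) _.
  by rewrite lerXn2r ?nnegrE ?normc_ge0 ?mulr_ge0 ?vnorm_ge0 ?normc_ip_le.
rewrite exprMn ler_wpM2r ?sqr_ge0 // sqr_vnorm; apply: ler_sum => j _.
by rewrite !mxE; case: (A i j) => a b /=; rewrite sqrrN.
Qed.

Lemma opnorm_ub p q (A : 'M[C]_(p, q)) : has_ubound
  [set x : R | exists v : 'cV[C]_q, vnorm v <= 1 /\ x = vnorm (A *m v)]%classic.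
Proof.
exists (Num.sqrt (hs2 A)) => _ [v [v1 ->]].
rewrite -[leLHS]ger0_norm ?vnorm_ge0 // -sqrtr_sqr ler_wsqrtr //.
apply: le_trans (sqr_vnorm_mulmx A v) _.
by rewrite ler_piMr ?hs2_ge0 // expr_le1 ?vnorm_ge0.
Qed.

Lemma opnorm_ge0 p q (A : 'M[C]_(p, q)) : 0 <= opnorm A.
Proof.
by apply: ub_le_sup (opnorm_ub A) _ _; exists 0; rewrite mulmx0 !vnorm0.
Qed.

Lemma vnorm_mulmx_le p q (A : 'M[C]_(p, q)) (v : 'cV_q) :
  vnorm (A *m v) <= opnorm A * vnorm v.
Proof.
have [v0|v0] := eqVneq (vnorm v) 0.
  move/eqP: (v0); rewrite vnorm_eq0 => /eqP ->; rewrite mulmx0.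
  by rewrite !vnorm0 mulr0.
have vp : 0 < vnorm v by rewrite lt_neqAle eq_sym v0 vnorm_ge0.
have iv0 : 0 <= (vnorm v)^-1 by rewrite invr_ge0 vnorm_ge0.
rewrite -ler_pdivrMr // mulrC -vnormZ // scalemxAr.
apply: ub_le_sup (opnorm_ub A) _ _; eexists; split; last by [].
by rewrite vnormZ // mulVf.
Qed.

Lemma opnorm_le p q (A : 'M[C]_(p, q)) (c : R) : 0 <= c ->
  (forall v, vnorm (A *m v) <= c * vnorm v) -> opnorm A <= c.
Proof.
move=> c0 H; apply: ge_sup.
  by exists (vnorm (A *m 0)), 0; rewrite vnorm0.
move=> _ [v [v1 ->]]; apply: le_trans (H v) _.
by rewrite ler_piMr.
Qed.

Lemma opnormB p q (A B : 'M[C]_(p, q)) :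
  opnorm (A - B) <= opnorm A + opnorm B.
Proof.
apply: opnorm_le => [|v]; first by rewrite addr_ge0 ?opnorm_ge0.
rewrite mulmxBl mulrDl; apply: le_trans (vnormB _ _) _.
by apply: lerD; apply: vnorm_mulmx_le.
Qed.

(** The form [<w, . v>] of the sum is [\sum_i t_i <D_i w, A D_i v>], at most [opnorm A] times
    [\sum_i t_i |D_i w| |D_i v|]. The normalization gives [\sum_i t_i |D_i v|^2 = c |v|^2], so
    weighted Cauchy-Schwarz finishes. *)
Lemma opnorm_kraus q (I : finType) (t : I -> R) (D : I -> 'M[C]_q)
    (c : R) (A : 'M[C]_q) :
  (forall i, 0 <= t i) -> 0 <= c ->
  \sum_i (t i)%:C *: (adj (D i) *m D i) = c%:C%:M ->
  opnorm (\sum_i (t i)%:C *: (adj (D i) *m A *m D i)) <= c * opnorm A.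
Proof.
move=> t0 c0 tD.
have tDv v : \sum_i t i * vnorm (D i *m v) ^+ 2 = c * vnorm v ^+ 2.
  apply: complexI; rewrite rmorph_sum rmorphM /= -ipvv.
  transitivity (ip v ((\sum_i (t i)%:C *: (adj (D i) *m D i)) *m v)).
    rewrite mulmx_suml; under [X in ip _ X]eq_bigr do rewrite -scalemxAl.
    rewrite ip_sum; apply: eq_bigr => i _.
    by rewrite rmorphM /= -ipvv -mulmxA -[in RHS]ip_adj adjK.
  by rewrite tD mul_scalar_mx /ip -scalemxAr mxE.
apply: opnorm_le => [|v]; first by rewrite mulr_ge0 ?opnorm_ge0.
apply: vnorm_le_ip => [|w]; first by rewrite !mulr_ge0 ?opnorm_ge0 ?vnorm_ge0.
rewrite mulmx_suml; under [X in ip _ X]eq_bigr do rewrite -scalemxAl.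
rewrite ip_sum; apply: le_trans (ler_normc_sum _) _.
(* The constant [c] is split evenly between the two Cauchy-Schwarz factors. *)
pose s := Num.sqrt c.
have ss x : c * x ^+ 2 = (s * x) ^+ 2 by rewrite exprMn sqr_sqrtr.
apply: le_trans (_ : _ <= opnorm A *
   \sum_i t i * (vnorm (D i *m w) * vnorm (D i *m v))) _.
  rewrite mulr_sumr; apply: ler_sum => i _.
  rewrite normc_realM // mulrCA ler_wpM2l // -!mulmxA -ip_adj adjK.
  apply: le_trans (normc_ip_le _ _) _; rewrite mulrCA.
  by rewrite ler_wpM2l ?vnorm_ge0 // vnorm_mulmx_le.
have -> : vnorm w * (c * opnorm A * vnorm v) =
    opnorm A * ((s * vnorm w) * (s * vnorm v)).
  by rewrite -(sqr_sqrtr c0) -/s; ring.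
rewrite ler_wpM2l ?opnorm_ge0 //.
apply: weighted_cauchy_schwarz_le => //;
  by rewrite ?mulr_ge0 ?sqrtr_ge0 ?vnorm_ge0 // tDv ss.
Qed.

End Norms.

(** * Amplifications to block matrices and completely bounded estimates *)

Section Blocks.
Variable R : realType.
Local Notation C := (R[i]).
Local Notation normc := (@Normc.normc R).
Local Notation "x %:C" := (real_complex R x).

Lemma adj_mxdiag k n (K : 'I_k -> 'M[C]_n) :
  adj (\mxdiag_i K i) = \mxdiag_i adj (K i).
Proof.
rewrite /adj -tr_mxdiag; congr trmx; rewrite /mxdiag.
have -> (B : 'I_k -> 'I_k -> 'M[C]_n) : map_mx (@conjc R) (blk B) =
    blk (fun i j => map_mx (@conjc R) (B i j)).
  by apply/matrixP => s t; rewrite !mxE.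
apply/eq_mxblock => i j.
by case: eqVneq => _; rewrite ?conform_mx_id ?map_mx0.
Qed.

(** Real weights stay outside the operators, so a convex combination of automorphisms has this form
    with [K] unitary, and no square roots of weights appear. *)
Definition kraus n (I : finType) (t : I -> R) (K : I -> 'M[C]_n)
    (x : 'M[C]_n) : 'M[C]_n :=
  \sum_i (t i)%:C *: (adj (K i) *m x *m K i).

(** Unlike [cbnorm T <= c], this also records that the supremum in [cbnorm] is taken over a bounded
    set; [sup] of an unbounded set carries no information. *)
Definition cb_le n (T : 'M[C]_n -> 'M[C]_n) (c : R) :=
  forall k (B : 'I_k -> 'I_k -> 'M[C]_n),
    opnorm (blk (fun i j => T (B i j))) <= c * opnorm (blk B).

Lemma eq_cb_le n (T S : 'M[C]_n -> 'M[C]_n) c :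
  T =1 S -> cb_le S c -> cb_le T c.
Proof. by move=> /boolp.funext ->. Qed.

(** The amplification to [k] by [k] blocks is again of Kraus form, with block-diagonal operators
    [D i], and it sends the identity to [c] times the identity; [opnorm_kraus] then applies for
    every [k]. *)
Lemma kraus_cb_le n (I : finType) (t : I -> R) (K : I -> 'M[C]_n) (c : R) :
  (forall i, 0 <= t i) -> 0 <= c -> kraus t K 1%:M = c%:C%:M ->
  cb_le (kraus t K) c.
Proof.
move=> t0 c0 K1 k B; pose D i := \mxdiag_(j < k) K i.
have scale_blk (s : C) (B' : 'I_k -> 'I_k -> 'M[C]_n) :
    s *: blk B' = blk (fun i j => s *: B' i j).
  by apply/matrixP => i j; rewrite !mxE.
have -> : blk (fun i j => kraus t K (B i j)) =
    \sum_i (t i)%:C *: (adj (D i) *m blk B *m D i).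
  rewrite /blk mxblock_sum; apply: eq_bigr => i _.
  rewrite -[mxblock _]/(blk _) -(scale_blk _ (fun j l => adj _ *m B j l *m _)).
  congr (_ *: _).
  by rewrite adj_mxdiag mul_mxdiag_mxblock mul_mxblock_mxdiag.
apply: opnorm_kraus => //.
have -> : \sum_i (t i)%:C *: (adj (D i) *m D i) =
    \mxdiag_(j < k) kraus t K 1%:M.
  rewrite mxdiag_sum; apply: eq_bigr => i _.
  rewrite adj_mxdiag mulmx1 {2}/mxdiag mul_mxdiag_mxblock.
  rewrite /mxdiag scale_blk; apply: eq_mxblock => j l.
  by case: eqVneq => _; rewrite ?conform_mx_id ?mulmx0 ?scaler0.
by rewrite K1 mxdiagZ.
Qed.

Lemma cb_leB n (T S : 'M[C]_n -> 'M[C]_n) c d :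
  cb_le T c -> cb_le S d -> cb_le (fun x => T x - S x) (c + d).
Proof.
move=> HT HS k B; rewrite /blk mxblockB mulrDl.
by apply: le_trans (opnormB _ _) (lerD (HT _ _) (HS _ _)).
Qed.

Lemma cbnorm_ub n (T : 'M[C]_n -> 'M[C]_n) c : 0 <= c -> cb_le T c -> ubound
  [set x : R | exists (k : nat) (B : 'I_k -> 'I_k -> 'M[C]_n),
     opnorm (blk B) <= 1 /\ x = opnorm (blk (fun i j => T (B i j)))]%classic c.
Proof.
by move=> c0 Tc _ [k [B [B1 ->]]]; apply: le_trans (Tc _ _) _; rewrite ler_piMr.
Qed.

Lemma cbnorm_le n (T : 'M[C]_n -> 'M[C]_n) c :
  0 <= c -> cb_le T c -> cbnorm T <= c.
Proof.
move=> c0 Tc; apply: ge_sup (cbnorm_ub c0 Tc).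
(* The supremum needs a nonempty set. The empty block matrix acts as the identity on the zero space,
   so its norm is at most 1. *)
pose B (_ _ : 'I_0) : 'M[C]_n := 0.
exists (opnorm (blk (fun i j => T (B i j)))), 0%N, B; split => //.
apply: opnorm_le => // v; rewrite mul1r.
have -> : blk B *m v = v by apply/mxcolP => -[].
by [].
Qed.

Lemma cbnorm_ge n (T : 'M[C]_n -> 'M[C]_n) c k (B : 'I_k -> 'I_k -> 'M[C]_n) :
  0 <= c -> cb_le T c -> opnorm (blk B) <= 1 ->
  opnorm (blk (fun i j => T (B i j))) <= cbnorm T.
Proof.
move=> c0 Tc B1; apply: ub_le_sup; last by exists k, B.
by exists c; apply: cbnorm_ub.
Qed.

Lemma blk_mulmx k n (B : 'I_k -> 'I_k -> 'M[C]_n) (V : 'I_k -> 'cV[C]_n) :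
  blk B *m \mxcol_i V i = \mxcol_i \sum_j B i j *m V j.
Proof.
rewrite /blk mxblockEh mul_mxrow_mxcol mxcol_sum.
by apply: eq_bigr => j _; rewrite mxcol_mul.
Qed.

Lemma ip_mxcol k n (V W : 'I_k -> 'cV[C]_n) :
  ip (\mxcol_i V i) (\mxcol_i W i) = \sum_i ip (V i) (W i).
Proof.
under [RHS]eq_bigr do rewrite ipE.
rewrite ipE sig_big_dep /= (reindex _ tagnat.sig_bij_on) /=.
by apply: eq_bigr => s _; rewrite !mxE.
Qed.

Lemma sqr_vnorm_mxcol k n (V : 'I_k -> 'cV[C]_n) :
  vnorm (\mxcol_i V i) ^+ 2 = \sum_i vnorm (V i) ^+ 2.
Proof.
apply: complexI; rewrite -ipvv ip_mxcol rmorph_sum.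
by apply: eq_bigr => i _; rewrite ipvv.
Qed.

(** Blocks of the tensor flip, which exchanges the two factors of [C^n (x) C^n]. *)
Definition flip n (i j : 'I_n) : 'M[C]_n := delta_mx j i.

(** Coordinate [p] of block [i] of the image is coordinate [i] of block [p] of [v], so the flip
    permutes coordinates and is isometric. *)
Lemma opnorm_flip n : opnorm (blk (@flip n)) <= 1.
Proof.
apply: opnorm_le => // v; rewrite mul1r -(submxcolK v) blk_mulmx.
move: (submxcol v) => V; rewrite -(@ler_pXn2r _ 2) ?nnegrE ?vnorm_ge0 //.
rewrite !sqr_vnorm_mxcol; under eq_bigr do rewrite sqr_vnorm.
rewrite exchange_big /= le_eqVlt; apply/orP; left; apply/eqP.
apply: eq_bigr => p _; rewrite sqr_vnorm; apply: eq_bigr => i _.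
congr (normc _ ^+ 2); rewrite summxE (bigD1 p) //= big1 ?addr0 => [|j jp].
  rewrite mxE (bigD1 i) //= big1 ?addr0 => [|q qi].
    by rewrite mxE !eqxx mul1r.
  by rewrite mxE (negPf qi) andbF mul0r.
rewrite mxE big1 // => q _.
by rewrite mxE eq_sym (negPf jp) mul0r.
Qed.

Lemma cbnorm_ge0 n (T : 'M[C]_n -> 'M[C]_n) c :
  0 <= c -> cb_le T c -> 0 <= cbnorm T.
Proof.
move=> c0 Tc; apply: le_trans (opnorm_ge0 _) (cbnorm_ge c0 Tc _).
exact: (@opnorm_flip n).
Qed.

(** The double sum is [<v, blk B v>] for the unnormalized maximally entangled vector
    [v = \sum_i e_i (x) e_i], and [|v|^2 = n]. *)
Lemma opnorm_blk_ge n (B : 'I_n -> 'I_n -> 'M[C]_n) :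
  normc (\sum_i \sum_j B i j i j) <= n%:R * opnorm (blk B).
Proof.
pose v : 'cV[C]_(\sum_(i < n) n) := \mxcol_(i < n) (delta_mx i 0 : 'cV[C]_n).
have v2 : vnorm v ^+ 2 = n%:R.
  rewrite sqr_vnorm_mxcol -[n in RHS]card_ord -sumr_const.
  apply: eq_bigr => i _; rewrite sqr_vnorm (bigD1 i) //= big1 => [|j ji].
    by rewrite mxE !eqxx Normc.normc1 addr0 expr1n.
  by rewrite mxE (negPf ji) Normc.normc0 expr0n.
have <- : ip v (blk B *m v) = \sum_i \sum_j B i j i j.
  rewrite blk_mulmx ip_mxcol; apply: eq_bigr => i _.
  rewrite ipE (bigD1 i) //= [X in _ + X]big1 => [|j ji].
    rewrite mxE !eqxx conjc1 mul1r addr0 summxE; apply: eq_bigr => j _.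
    by rewrite -colE mxE.
  by rewrite mxE (negPf ji) conjc0 mul0r.
apply: le_trans (normc_ip_le _ _) _.
rewrite -v2 expr2 -mulrA ler_wpM2l ?vnorm_ge0 // mulrC.
exact: vnorm_mulmx_le.
Qed.

End Blocks.

(** * Kraus forms and cb bounds of the maps involved *)

Section Channels.
Variable R : realType.
Local Notation C := (R[i]).
Local Notation normc := (@Normc.normc R).
Local Notation "x %:C" := (real_complex R x).

Lemma adj_delta m n (i : 'I_m) (j : 'I_n) :
  adj (delta_mx i j : 'M[C]_(m, n)) = delta_mx j i.
Proof. by rewrite /adj map_delta_mx trmx_delta. Qed.

Lemma adjB m n (A B : 'M[C]_(m, n)) : adj (A - B) = adj A - adj B.
Proof. by rewrite /adj map_mxB linearB. Qed.

Lemma mul_delta_mx_delta n (x : 'M[C]_n) (i j k l : 'I_n) :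
  delta_mx j i *m x *m delta_mx k l = x i k *: delta_mx j l.
Proof.
rewrite {1}(matrix_sum_delta x) mulmx_sumr mulmx_suml (bigD1 i) //=.
rewrite [X in _ + X]big1 => [|a ai]; last first.
  rewrite mulmx_sumr mulmx_suml big1 // => b _.
  by rewrite -scalemxAr -scalemxAl mul_delta_mx_0 1?eq_sym // mul0mx scaler0.
rewrite addr0 mulmx_sumr mulmx_suml (bigD1 k) //= [X in _ + X]big1.
  by rewrite addr0 -scalemxAr -scalemxAl !mul_delta_mx.
move=> b bk.
by rewrite -scalemxAr -scalemxAl mul_delta_mx mul_delta_mx_0 // scaler0.
Qed.

(** The scale is left free: [1/(n-1)] gives the Holevo-Werner channel, [1/n] occurs in the averaged
    automorphisms, and the upper bound uses the difference of the two. *)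
Definition skew_part n (s : R) (x : 'M[C]_n) : 'M[C]_n :=
  s%:C *: ((\tr x)%:M - x^T).

Definition diag_part n (s : R) (x : 'M[C]_n) : 'M[C]_n :=
  s%:C *: \sum_i x i i *: delta_mx i i.

Lemma scalar_mx_sum_delta n (a : C) :
  a%:M = \sum_(i < n) a *: delta_mx i i :> 'M_n.
Proof.
rewrite (matrix_sum_delta a%:M); apply: eq_bigr => i _.
rewrite (bigD1 i) //= big1 => [|j ji]; first by rewrite mxE eqxx addr0.
by rewrite mxE eq_sym (negPf ji) scale0r.
Qed.

Lemma diag_part_kraus n s (x : 'M[C]_n) :
  diag_part s x = kraus (fun=> s) (fun i => delta_mx i i) x.
Proof.
rewrite /diag_part /kraus scaler_sumr; apply: eq_bigr => i _.
by rewrite adj_delta mul_delta_mx_delta.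
Qed.

(** The operators [E_ij - E_ji] run over ordered pairs, so each unordered pair counts twice and the
    weight is [s / 2]; the diagonal pairs contribute 0. *)
Lemma skew_part_kraus n s (x : 'M[C]_n) :
  skew_part s x = kraus (fun=> s / 2)
    (fun ij : 'I_n * 'I_n => delta_mx ij.1 ij.2 - delta_mx ij.2 ij.1) x.
Proof.
rewrite /kraus -(pair_bigA _ (fun i j => (s / 2)%:C *:
  (adj (delta_mx i j - delta_mx j i) *m x *m (delta_mx i j - delta_mx j i)))) /=.
have trE : \sum_i \sum_j x i i *: delta_mx j j = (\tr x)%:M :> 'M_n.
  rewrite exchange_big [RHS]scalar_mx_sum_delta /=.
  by apply: eq_bigr => i _; rewrite -scaler_suml.
have xTE : \sum_i \sum_j x i j *: delta_mx j i = x^T.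
  rewrite exchange_big [RHS]matrix_sum_delta /=.
  by apply: eq_bigr => i _; apply: eq_bigr => j _; rewrite mxE.
have trE' := trE; rewrite exchange_big /= in trE'.
have xTE' := xTE; rewrite exchange_big /= in xTE'.
(* Expanding one Kraus term gives four matrix units; over all pairs the positive ones sum to twice
   the scalar trace, the negative ones to twice the transpose. *)
transitivity ((s / 2)%:C *: \sum_i \sum_j
    ((x i i *: delta_mx j j - x i j *: delta_mx j i) +
     (x j j *: delta_mx i i - x j i *: delta_mx i j))); last first.
  rewrite scaler_sumr; apply: eq_bigr => i _.
  rewrite scaler_sumr; apply: eq_bigr => j _.
  by rewrite adjB !adj_delta 2!mulmxBl !mulmxBr !mul_delta_mx_delta opprB.
under eq_bigr do rewrite big_split !sumrB /=.
rewrite big_split !sumrB /= trE trE' xTE xTE'.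
by rewrite -mulr2n -scaler_nat scalerA -(rmorph_nat (real_complex R)) -rmorphM
  divfK ?pnatr_eq0.
Qed.

Lemma cb_le_diag_part n s : 0 <= s -> cb_le (@diag_part n s) s.
Proof.
move=> s0; apply: eq_cb_le (@diag_part_kraus n s) _.
apply: kraus_cb_le => //; rewrite -diag_part_kraus /diag_part.
rewrite scalar_mx_sum_delta scaler_sumr; apply: eq_bigr => i _.
by rewrite scalerA mxE eqxx mulr1.
Qed.

(** In size [n + 1] the identity is sent to [s * ((n + 1) - 1)] times itself. *)
Lemma cb_le_skew_part n s : 0 <= s -> cb_le (@skew_part n.+1 s) (s * n%:R).
Proof.
move=> s0; apply: eq_cb_le (@skew_part_kraus n.+1 s) _.
apply: kraus_cb_le => [_||]; rewrite ?divr_ge0 ?mulr_ge0 //.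
rewrite -skew_part_kraus /skew_part mxtrace1 tr_scalar_mx -raddfB /=.
rewrite mulrSr addrK scale_scalar_mx; congr (_%:M).
by rewrite rmorphM rmorph_nat.
Qed.

Lemma conv_Aut_cb_le n (Q : 'M[C]_n -> 'M[C]_n) :
  conv (@Aut R n) Q -> cb_le Q 1.
Proof.
case=> m [l [F [l0 [l1 [FA ->]]]]].
have [u uP] := boolp.choice FA.
have QE x : \sum_i (l i)%:C *: F i x = kraus l u x.
  by apply: eq_bigr => i _; case: (uP i) => _ ->.
apply: eq_cb_le QE _; apply: kraus_cb_le => //; rewrite /kraus.
under eq_bigr => i _ do rewrite mulmx1 (mulmx1C (proj1 (uP i))).
by rewrite -scaler_suml -rmorph_sum l1 rmorph1 scale1r.
Qed.

Lemma WminusE n (x : 'M[C]_n) : Wminus x = skew_part (n.-1%:R)^-1 x.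
Proof. by rewrite /Wminus /skew_part fmorphV rmorph_nat. Qed.

Lemma Wminus_cb_le n : cb_le (@Wminus R n.+2) 1.
Proof.
rewrite -[1](@mulVf _ n.+1%:R) ?pnatr_eq0 //.
apply: eq_cb_le (@WminusE n.+2) _.
by apply: cb_le_skew_part; rewrite invr_ge0.
Qed.

End Channels.

(** * Lower bound by pairing with the flip *)

Section LowerBound.
Variable R : realType.
Local Notation C := (R[i]).
Local Notation Re := (@complex.Re R).
Local Notation normc := (@Normc.normc R).
Local Notation "x %:C" := (real_complex R x).

(** In odd size [\det a = \det a^T = \det (- a) = - \det a], so the determinant vanishes. *)
Lemma odd_antisym_singular n (a : 'M[C]_n) : odd n -> a^T = - a ->
  exists2 w : 'cV[C]_n, w != 0 & a *m w = 0.
Proof.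
move=> on aT; have : \det a == 0.
  have : \det a = - \det a.
    by rewrite -{1}det_tr aT -scaleN1r detZ -signr_odd on expr1 mulN1r.
  by move/eqP; rewrite -addr_eq0 -mulr2n mulrn_eq0 /=.
case/det0P => v v0 va; exists v^T; first by rewrite trmx_eq0.
by apply: trmx_inj; rewrite trmx_mul trmxK aT mulmxN va oppr0 trmx0.
Qed.

Lemma hs2_unitary n (u : 'M[C]_n) : unitary u -> hs2 u = n%:R.
Proof.
move=> uu; apply: complexI; rewrite rmorph_nat -mxtrace1 -uu /mxtrace /hs2.
rewrite rmorph_sum; apply: eq_bigr => i _; rewrite rmorph_sum mxE /=.
by apply: eq_bigr => j _; rewrite !mxE mulrC sqr_normc_mul.
Qed.

Lemma Re_sum (I : finType) (F : I -> C) : Re (\sum_i F i) = \sum_i Re (F i).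
Proof. by apply: (big_morph Re) => // -[a b] [c d]. Qed.

Lemma sqr_normcD (x y : C) :
  normc (x + y) ^+ 2 = normc x ^+ 2 + normc y ^+ 2 + 2 * Re (conjc y * x).
Proof. by case: x y => a b [c d]; rewrite !sqr_normcE /=; ring. Qed.

(* [u - u^T] has a null vector [w], so [u + u^T] acts as [2 u] on [w] and its
   Hilbert-Schmidt norm is at least [2]. *)
Lemma unitary_transpose_overlap n (u : 'M[C]_n) : odd n -> unitary u ->
  2 - n%:R <= \sum_i \sum_j Re (conjc (u j i) * u i j).
Proof.
move=> on uu; have [|w w0 aw] := @odd_antisym_singular n (u - u^T) on.
  by rewrite linearB /= trmxK opprB.
have bw : (u + u^T) *m w = (2 : R)%:C *: (u *m w).
  move/eqP: aw; rewrite mulmxBl subr_eq0 => /eqP aw.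
  by rewrite mulmxDl -aw -mulr2n -scaler_nat rmorph_nat.
have uw : vnorm (u *m w) ^+ 2 = vnorm w ^+ 2.
  by apply: complexI; rewrite -!ipvv -ip_adj mulmxA (mulmx1C uu) mul1mx.
have wp : 0 < vnorm w ^+ 2 by rewrite exprn_even_gt0 //= vnorm_eq0.
have := sqr_vnorm_mulmx (u + u^T) w.
rewrite bw vnormZ // exprMn uw ler_pM2r // => H.
(* With [hs2 u = n] this turns [4 <= hs2 (u + u^T)] into the claim. *)
have E : hs2 (u + u^T) =
    hs2 u + hs2 u + 2 * \sum_i \sum_j Re (conjc (u j i) * u i j).
  have hs2T : hs2 u = \sum_i \sum_j normc (u j i) ^+ 2.
    by rewrite /hs2 exchange_big.
  rewrite {2}hs2T /hs2 mulr_sumr -!big_split /=.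
  apply: eq_bigr => i _; rewrite mulr_sumr -!big_split /=.
  by apply: eq_bigr => j _; rewrite !mxE sqr_normcD.
by move: H; rewrite E hs2_unitary //; lra.
Qed.

(** This is [n] times the diagonal coefficient of the amplified [T], applied to the flip, at the
    normalized maximally entangled vector. *)
Definition flip_pairing n (T : 'M[C]_n -> 'M[C]_n) : C :=
  \sum_i \sum_j T (flip R i j) i j.

Lemma flip_pairing_le n (T : 'M[C]_n -> 'M[C]_n) c :
  0 <= c -> cb_le T c -> normc (flip_pairing T) <= n%:R * cbnorm T.
Proof.
move=> c0 Tc; apply: le_trans (opnorm_blk_ge _) _.
by rewrite ler_wpM2l // (cbnorm_ge c0 Tc) // opnorm_flip.
Qed.

(** In size [N = n + 2], each of the [N (N - 1)] off-diagonal index pairs contributes [-1/(N - 1)];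
    on the diagonal, trace and transpose cancel. *)
Lemma flip_pairing_Wminus n : flip_pairing (@Wminus R n.+2) = - n.+2%:R.
Proof.
have -> : flip_pairing (@Wminus R n.+2) =
    (n.+1%:R)^-1 * \sum_(i < n.+2) \sum_(j < n.+2) ((i == j)%:R - 1).
  rewrite mulr_sumr; apply: eq_bigr => i _; rewrite mulr_sumr.
  apply: eq_bigr => j _; rewrite /Wminus !mxE !eqxx /flip; congr (_ * (_ - _)).
  rewrite /mxtrace (bigD1 j) //= big1 => [|k kj].
    by rewrite mxE eqxx eq_sym addr0; case: eqP.
  by rewrite mxE (negPf kj).
have -> : \sum_(i < n.+2) \sum_(j < n.+2) ((i == j)%:R - 1) =
    - (n.+1%:R * n.+2%:R) :> C.
  rewrite (eq_bigr (fun=> - n.+1%:R)) => [|i _].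
    by rewrite sumr_const card_ord mulNrn -natrM mulrnA.
  rewrite sumrB sumr_const card_ord (bigD1 i) //= big1 => [|j ji].
    by rewrite eqxx addr0 mulrS opprD addrA subrr sub0r.
  by rewrite eq_sym (negPf ji).
by rewrite mulrN mulKf // pnatr_eq0.
Qed.

(** The pairing is linear in the map, so the bound for a single automorphism passes to convex
    combinations. *)
Lemma flip_pairing_conv n (Q : 'M[C]_n -> 'M[C]_n) :
  odd n -> conv (@Aut R n) Q -> 2 - n%:R <= Re (flip_pairing Q).
Proof.
move=> on [m [l [F [l0 [l1 [FA ->]]]]]].
have -> : flip_pairing (fun x => \sum_i (l i)%:C *: F i x) =
    \sum_i (l i)%:C * flip_pairing (F i).
  rewrite /flip_pairing; under [RHS]eq_bigr do rewrite mulr_sumr.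
  rewrite [RHS]exchange_big; apply: eq_bigr => i _ /=.
  under [RHS]eq_bigr do rewrite mulr_sumr.
  rewrite [RHS]exchange_big; apply: eq_bigr => j _ /=.
  by rewrite summxE; apply: eq_bigr => k _; rewrite mxE.
have -> : 2 - n%:R = \sum_i l i * (2 - n%:R) by rewrite -mulr_suml l1 mul1r.
rewrite Re_sum; apply: ler_sum => i _.
have [u [uu ->]] := FA i.
have -> (r : R) (z : C) : Re (r%:C * z) = r * Re z.
  by case: z => a b /=; rewrite mul0r subr0.
rewrite ler_wpM2l //.
apply: le_trans (unitary_transpose_overlap on uu) _.
rewrite le_eqVlt; apply/orP; left; apply/eqP.
rewrite /flip_pairing Re_sum; apply: eq_bigr => a _.
rewrite Re_sum; apply: eq_bigr => b _; congr Re.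
(* Entry [(a, b)] of [u^* E_ba u] is the conjugate of [u b a] times [u a b]. *)
rewrite -mulmxA mxE (bigD1 b) //= big1 ?addr0 => [|c cb].
  rewrite !mxE (bigD1 a) //= big1 ?addr0 => [|c ca].
    by rewrite mxE !eqxx mul1r.
  by rewrite mxE (negPf ca) andbF mul0r.
by rewrite !mxE big1 ?mulr0 // => d _; rewrite mxE (negPf cb) mul0r.
Qed.

(** With [N = n + 2], the pairing of the difference has real part at most [- N - (2 - N) = -2], so
    its modulus is at least 2; dividing by [N] gives the bound. *)
Lemma cbnorm_Wminus_ge n (Q : 'M[C]_n.+2 -> 'M[C]_n.+2) :
  odd n.+2 -> conv (@Aut R n.+2) Q ->
  2 / n.+2%:R <= cbnorm (fun x => Wminus x - Q x).
Proof.
move=> on cQ; have H := flip_pairing_le (addr_ge0 ler01 ler01)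
  (cb_leB (@Wminus_cb_le R n) (conv_Aut_cb_le cQ)).
rewrite ler_pdivrMr ?ltr0n // mulrC; apply: le_trans H.
have -> : flip_pairing (fun x => Wminus x - Q x) =
    - n.+2%:R - flip_pairing Q.
  rewrite -flip_pairing_Wminus -sumrB; apply: eq_bigr => i _.
  by rewrite -sumrB; apply: eq_bigr => j _; rewrite !mxE.
have {}H := flip_pairing_conv on cQ.
rewrite -opprD normcN -lecR; apply: le_trans (normc_ge_Re _).
rewrite lecR; apply: le_trans (ler_norm _).
rewrite -(rmorph_nat (real_complex R)).
case: (flip_pairing Q) H => a b /=; lra.
Qed.

End LowerBound.

(** * Upper bound by averaging signed anti-diagonal unitaries *)

Lemma sum_sign_prod (I : finType) (A : numDomainType) (i j : I) :
  \sum_(e : {ffun I -> bool}) (-1) ^+ e i * (-1) ^+ e j =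
  (2 ^ #|I| * (i == j))%N%:R :> A.
Proof.
have [->|ij] := eqVneq i j.
  under eq_bigr do rewrite -signr_addb addbb.
  by rewrite sumr_const card_ffun card_bool muln1.
rewrite muln0; set S := \sum_e _; suff : S = - S.
  by move/eqP; rewrite -addr_eq0 -mulr2n mulrn_eq0 => /eqP.
(* Flipping the sign at [i] alone is an involution that negates every summand, since [j] differs
   from [i]. *)
pose h (e : {ffun I -> bool}) := [ffun k => e k (+) (k == i)].
have hK : involutive h by move=> e; apply/ffunP => k; rewrite !ffunE addbK.
rewrite {1}/S (reindex h) /=; last by exists h => e _; apply: hK.
rewrite -sumrN; apply: eq_bigr => e _.
by rewrite !ffunE eqxx eq_sym (negPf ij) addbF addbT signrN mulNr.
Qed.

Section UpperBound.
Variable R : realType.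
Local Notation C := (R[i]).
Local Notation "x %:C" := (real_complex R x).

(** [conv] is indexed by ordinals; the combination over [I] is carried there along [enum_val]. *)
Lemma conv_Aut_kraus n (I : finType) (l : I -> R) (u : I -> 'M[C]_n) :
  (forall i, 0 <= l i) -> \sum_i l i = 1 -> (forall i, unitary (u i)) ->
  conv (@Aut R n) (kraus l u).
Proof.
move=> l0 l1 uu.
exists #|I|, (l \o enum_val).
exists (fun i x => adj (u (enum_val i)) *m x *m u (enum_val i)).
have bij : {on [pred _ | true], bijective (@enum_val I I)}.
  exact: onW_bij (enum_val_bij _).
split=> [i|]; first exact: l0.
split; first by rewrite -l1 [RHS](reindex _ bij).
split=> [i|]; first by exists (u (enum_val i)).
apply: boolp.funext => x.
by rewrite /kraus [LHS](reindex _ bij).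
Qed.

(* [Order.min a p] labels the orbit [{a, p}], so that mirror entries share their
   random sign [ce.2]. *)
Definition reflection m (ce : 'I_m.+2 * {ffun 'I_m.+2 -> bool}) : 'M[C]_m.+2 :=
  \matrix_(a, p) (if a + p == ce.1 then
    (-1) ^+ (p < a)%N * (-1) ^+ ce.2 (Order.min a p) else 0).

Lemma adj_reflection m (ce : 'I_m.+2 * {ffun 'I_m.+2 -> bool}) :
  adj (reflection ce) = (reflection ce)^T.
Proof.
apply/matrixP => i j; rewrite !mxE; case: ifP => _; last exact: conjc0.
by rewrite rmorphM !rmorph_sign.
Qed.

Lemma reflection_unitary m (ce : 'I_m.+2 * {ffun 'I_m.+2 -> bool}) :
  unitary (reflection ce).
Proof.
rewrite /unitary adj_reflection; apply/matrixP => a b.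
case: ce => c e; rewrite !mxE (bigD1 (c - a)) //= big1 ?addr0 => [|p pc].
  rewrite !mxE /= addrCA subrr addr0 eqxx.
  have -> : (b + (c - a) == c) = (a == b).
    by rewrite addrCA -subr_eq0 addrAC subrr add0r subr_eq0 eq_sym.
  case: eqP => [->|_]; last by rewrite mulr0.
  by rewrite mulrACA -!expr2 !sqrr_sign mulr1.
rewrite !mxE /=; case: eqP => [E|_]; last by rewrite mul0r.
by case/eqP: pc; rewrite -E addrAC subrr add0r.
Qed.

(** The sum in Z/n and the minimum determine the unordered pair, so the left side says that [{a, p}]
    and [{b, q}] coincide. These are the pairs of entries whose product survives averaging. *)
Lemma reflection_key m (a b p q : 'I_m.+2) :
  (a + p == b + q) && (Order.min a p == Order.min b q) =
  if p == q then a == b else (a == q) && (b == p).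
Proof.
have [->|pq] := eqVneq p q.
  by rewrite (inj_eq (addIr q)); case: eqP => [->|//]; rewrite eqxx.
apply/andP/andP => [[/eqP E /eqP]|[/eqP -> /eqP ->]]; last first.
  by rewrite addrC minC.
rewrite /Order.min; case: ltP => _; case: ltP => _ F.
- by case/eqP: pq; apply: (addrI b); rewrite -E F.
- rewrite F; split => //; apply/eqP; apply: (addIr q).
  by rewrite -E F addrC.
- rewrite F in E *; split => //; apply/eqP; apply: (addIr b).
  by rewrite E addrC.
- by rewrite F eqxx in pq.
Qed.

Definition mean_reflection m : 'M[C]_m.+2 -> 'M[C]_m.+2 :=
  kraus (fun=> (m.+2%:R * 2 ^+ m.+2)^-1) (@reflection m).

(** Averaging leaves the trace at each diagonal entry and [- x q p] at an off-diagonal entry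
    [(p, q)], the sign coming from antisymmetry. The diagonal part cancels the [- x p p] present in
    [skew_part]. *)
Lemma mean_reflectionE m (x : 'M[C]_m.+2) :
  mean_reflection x = skew_part (m.+2%:R)^-1 x + diag_part (m.+2%:R)^-1 x.
Proof.
rewrite /mean_reflection /skew_part /diag_part -scalerDr /kraus -scaler_sumr.
rewrite invfM rmorphM -scalerA; congr (_ *: _).
(* Clearing the number of sign patterns matches the constant of [sum_sign_prod]. *)
apply: (scalerI (a := (2 ^+ m.+2)%:C)).
  by rewrite rmorphXn rmorph_nat expf_neq0 // pnatr_eq0.
rewrite scalerA -rmorphM mulfV ?expf_neq0 ?pnatr_eq0 // rmorph1 scale1r.
apply/matrixP => p q; rewrite summxE.
(* The deterministic sign of an entry, separated from the random one. *)
pose s (a p : 'I_m.+2) : C := (-1) ^+ (p < a)%N.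
transitivity (\sum_b \sum_a s a p * s b q * x a b *
   ((2 ^+ m.+2)%:C * (if p == q then a == b else (a == q) && (b == p))%:R)).
  transitivity (\sum_b \sum_a \sum_c \sum_e
    (reflection (c, e) a p * x a b * reflection (c, e) b q)).
    under eq_bigr => ce _.
      rewrite adj_reflection mxE.
      under eq_bigr => b _ do rewrite mxE mulr_suml.
      over.
    rewrite exchange_big; apply: eq_bigr => b _.
    rewrite exchange_big; apply: eq_bigr => a _.
    by rewrite pair_big; apply: eq_bigr => -[c e] _; rewrite !mxE.
  apply: eq_bigr => b _; apply: eq_bigr => a _.
  (* Entry [(a, p)] lies on the single anti-diagonal [c = a + p]. *)
  rewrite (bigD1 (a + p)) //= [X in _ + X]big1 ?addr0 => [|c cap]; last first.
    by rewrite big1 // => e _; rewrite !mxE /= eq_sym (negPf cap) !mul0r.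
  rewrite -reflection_key; have [E|E] := eqVneq (a + p) (b + q); last first.
    rewrite !mulr0 big1 // => e _.
    by rewrite !mxE /= [b + q == _]eq_sym (negPf E) mulr0.
  have := sum_sign_prod C (Order.min a p) (Order.min b q).
  rewrite card_ord natrM natrX rmorphXn rmorph_nat /= => <-.
  rewrite mulr_sumr; apply: eq_bigr => e _.
  rewrite !mxE /= E !eqxx /s; ring.
have diagE : (\sum_i x i i *: delta_mx i i) p q = (p == q)%:R * x p q.
  rewrite summxE (bigD1 p) //= big1 ?addr0 => [|i ip].
    rewrite !mxE eqxx eq_sym /= mulrC; case: eqP => [->|_] //.
    by rewrite !mul0r.
  by rewrite !mxE eq_sym (negPf ip) mulr0.
rewrite [RHS]mxE [in RHS]mxE [in RHS]mxE diagE !mxE.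
have [<-|pq] := eqVneq p q.
  rewrite mul1r subrK mulr_sumr; apply: eq_bigr => b _.
  rewrite (bigD1 b) //= big1 => [|a /negPf ->]; last by rewrite !mulr0.
  by rewrite eqxx /s -expr2 sqrr_sign mul1r mulr1 addr0 mulrC.
rewrite mul0r addr0 mulr0n sub0r.
rewrite (bigD1 p) //= [X in _ + X]big1 ?addr0 => [|b /negPf ->]; last first.
  by rewrite big1 // => a _; rewrite andbF !mulr0.
rewrite (bigD1 q) //= [X in _ + X]big1 ?addr0 => [|a /negPf ->]; last first.
  by rewrite !mulr0.
rewrite !eqxx mulr1 mulrC; congr (_ * _).
(* Exactly one of [p < q] and [q < p] holds, so the two deterministic signs multiply to [-1]. *)
rewrite /s; case: ltngtP => [_|_|/val_inj E]; last by rewrite E eqxx in pq.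
  by rewrite expr1 expr0 mulr1 mulN1r.
by rewrite expr1 expr0 mul1r mulN1r.
Qed.

Lemma conv_mean_reflection m : conv (@Aut R m.+2) (@mean_reflection m).
Proof.
apply: conv_Aut_kraus => [_||]; last exact: reflection_unitary.
  by rewrite invr_ge0 mulr_ge0 ?exprn_ge0.
rewrite sumr_const card_prod card_ffun card_bool card_ord.
rewrite -[LHS]mulr_natr natrM natrX mulVf //.
by rewrite mulf_neq0 ?expf_neq0 ?pnatr_eq0.
Qed.

Lemma dcb_Wminus_le m :
  dcb (@Wminus R m.+2) (conv (@Aut R m.+2)) <= 2 / m.+2%:R.
Proof.
pose N : R := m.+2%:R; have N0 : 0 < N by rewrite ltr0n.
apply: le_trans (_ : cbnorm (fun y => Wminus y - mean_reflection y) <= _).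
  apply: ge_inf; last first.
    by exists (@mean_reflection m); split=> //; apply: conv_mean_reflection.
  (* The infimum is bounded below by 0; the constant [1 + 1] certifies that each [cbnorm] is a
     supremum of a bounded set. *)
  exists 0 => _ [Q' [cQ' ->]]; apply: cbnorm_ge0 (addr_ge0 ler01 ler01) _.
  exact: cb_leB (@Wminus_cb_le R m) (conv_Aut_cb_le cQ').
(* With [N = m + 2], [r] is the scale left on [skew_part] after subtraction. Its cb bound is
   [r * (N - 1) = 1/N], and [diag_part] adds another [1/N]. *)
pose r : R := (m.+1%:R)^-1 - N^-1.
have r0 : 0 <= r.
  by rewrite subr_ge0 lef_pV2 ?posrE ?ltr0n // ler_nat.
have -> : (fun y => Wminus y - @mean_reflection m y) =
    (fun y => skew_part r y - diag_part N^-1 y).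
  apply: boolp.funext => y; rewrite WminusE mean_reflectionE -/N opprD addrA.
  by congr (_ - _); rewrite /skew_part -scalerBl -rmorphB.
have -> : 2 / N = r * m.+1%:R + N^-1.
  have mE : m.+1%:R = N - 1 by rewrite /N [in RHS]mulrSr addrK.
  rewrite /r mulrBl mulVf ?pnatr_eq0 // mE mulrBr mulVf ?gt_eqF //; ring.
apply: cbnorm_le.
  by rewrite addr_ge0 ?mulr_ge0 // invr_ge0 ltW.
apply: cb_leB; first exact: cb_le_skew_part.
by apply: cb_le_diag_part; rewrite invr_ge0 ltW.
Qed.

End UpperBound.

Theorem theorem4p10 (R : realType) (n : nat) :
  odd n -> (3 <= n)%N ->
  dcb (@Wminus R n) (conv (@Aut R n)) = 2 / n%:R.
Proof.
case: n => [|[|m]] // on _; apply/eqP; rewrite eq_le dcb_Wminus_le /=.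
(* A lower bound passes to the infimum of a nonempty set; the averaged map supplies an element. *)
apply: lb_le_inf.
  exists (cbnorm (fun y => Wminus y - @mean_reflection R m y)).
  by exists (@mean_reflection R m); split=> //; apply: conv_mean_reflection.
by move=> _ [Q' [cQ' ->]]; apply: cbnorm_Wminus_ge.
Qed.
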